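(* Let $\Gamma$ be a finite group, $n\ge 1$, and let $\gamma\in R(\Gamma)$ be a complex class function on $\Gamma$. Then the $2n$ elements $\xi_1,\ldots,\xi_n,\gamma^{(1)},\ldots,\gamma^{(n)}$ of the group algebra $\mathbb C[\Gamma_n]$ commute with each other under the convolution product (the product of $\mathbb C[\Gamma_n]$). Furthermore, $$\eta_n(\gamma)=(\gamma^{(1)}+\xi_1)(\gamma^{(2)}+\xi_2)\cdots(\gamma^{(n)}+\xi_n),$$ $$\varepsilon_n(\gamma)=(\gamma^{(1)}-\xi_1)(\gamma^{(2)}-\xi_2)\cdots(\gamma^{(n)}-\xi_n).$$
   Context: $\Gamma_*$ is the set of conjugacy classes of $\Gamma$. A function $f$ on a finite group $G$ is identified with $\sum_{x\in G}f(x)x\in\mathbb C[G]$; $R(G)$ denotes the space of complex class functions, identified with the center of $\mathbb C[G]$ (convolution product = product in $\mathbb C[G]$). The wreath product is $\Gamma_n=\Gamma^n\rtimes S_n=\{(g,\sigma)\}$ with $(g,\sigma)(h,\tau)=(g\,\sigma(h),\sigma\tau)$, where $\sigma(h_1,\ldots,h_n)=(h_{\sigma^{-1}(1)},\ldots,h_{\sigma^{-1}(n)})$. For $x=(g,\sigma)\in\Gamma_n$ and a cycle $(i_1 i_2\cdots i_k)$ of $\sigma$, the cycle-product is the conjugacy class of $g_{i_k}g_{i_{k-1}}\cdots g_{i_1}$ in $\Gamma$. The type of $x$ is $\rho=(\rho(c))_{c\in\Gamma_*}$, where $\rho(c)$ is the partition whose parts are the lengths of the cycles of $\sigma$ with cycle-product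 in $c$; $l(\rho(c))$ is its number of parts. $\Gamma^{(i)}$ is the $i$-th factor of $\Gamma^n\subset\Gamma_n$, and for $\gamma\in\mathbb C[\Gamma]$, $\gamma^{(i)}$ is the corresponding element of $\mathbb C[\Gamma^{(i)}]\subset\mathbb C[\Gamma_n]$. Jucys-Murphy elements: for $i<j$ let $K(i,j)$ be the set of elements $((g_1,\ldots,g_n),(i,j))\in\Gamma_n$ with $g_k=1$ for $k\ne i,j$ and $g_j=g_i^{-1}$ with $g_i$ running over $\Gamma$; then $\xi_j=\sum_{1\le i<j}\sum_{a\in K(i,j)}a\in\mathbb C[\Gamma_n]$ for $j=1,\dots,n$ (so $\xi_1=0$). $\eta_n(\gamma)\in R(\Gamma_n)$ is the class function with value $\prod_{c\in\Gamma_*}\gamma(c)^{l(\rho(c))}$ at elements of type $\rho$ (if $\gamma$ is the character of a $\Gamma$-module $V$, this is the character of $\Gamma_n$ on $V^{\otimes n}$). $\varepsilon_n(\gamma)\in R(\Gamma_n)$ is the product of $\eta_n(\gamma)$ with the sign character $(g,\sigma)\mapsto\mathrm{sgn}(\sigma)$, i.e. its value at $(g,\sigma)$ of type $\rho$ is $\mathrm{sgn}(\sigma)\prod_{c}\gamma(c)^{l(\rho(c))}$. *)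

(* Defs.v *)
From HB Require Import structures.
From mathcomp Require Import all_boot all_order all_algebra all_fingroup.
From mathcomp Require Import complex.
From mathcomp Require Import reals.

Set Implicit Arguments.
Unset Strict Implicit.
Unset Printing Implicit Defensive.

Import GRing.Theory.

Local Open Scope ring_scope.


(** The group algebra of G over R: functions f on G, standing for the formal
    sums of the f(x) x, with convolution as product. [grpalg] must stay a
    separate name, because {ffun G -> R} carries the pointwise product. *)
Definition grpalg (R : comNzRingType) (G : finGroupType) : Type :=
  {ffun G -> R}.

Section GroupAlgebra.
Variables (R : comNzRingType) (G : finGroupType).
Implicit Types f g h : grpalg R G.

HB.instance Definition _ :=
  GRing.Lmodule.copy (grpalg R G) {ffun G -> R^o}.

Definition grpalg_delta (x : G) : grpalg R G := [ffun y => (y == x)%:R].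

Definition grpalg_mul f g : grpalg R G :=
  [ffun x => \sum_(y : G) f y * g (y^-1 * x)%g].

Fact grpalg_mulA : associative grpalg_mul.
Proof.
move=> f g h; apply/ffunP => x; rewrite !ffunE.
under eq_bigr => y _ do rewrite ffunE mulr_sumr.
under [RHS]eq_bigr => y _ do rewrite ffunE mulr_suml.
rewrite [RHS]exchange_big /=; apply: eq_bigr => y _.
rewrite [RHS](reindex_inj (mulgI y)) /=; apply: eq_bigr => z _.
by rewrite mulKg invMg mulgA mulrA.
Qed.

Fact grpalg_mul1l : left_id (grpalg_delta 1%g) grpalg_mul.
Proof.
move=> f; apply/ffunP => x; rewrite !ffunE (bigD1 1%g) //= ffunE eqxx mul1r.
rewrite invg1 mul1g big1 ?addr0 // => y /negPf ny.
by rewrite ffunE ny mul0r.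
Qed.

Fact grpalg_mul1r : right_id (grpalg_delta 1%g) grpalg_mul.
Proof.
move=> f; apply/ffunP => x; rewrite !ffunE (bigD1 x) //= ffunE mulVg eqxx mulr1.
rewrite big1 ?addr0 // => y /negPf ny.
by rewrite ffunE -eq_mulVg1 ny mulr0.
Qed.

Fact grpalg_mulDl : left_distributive grpalg_mul +%R.
Proof.
move=> f g h; apply/ffunP => x; rewrite !ffunE -big_split /=.
by apply: eq_bigr => y _; rewrite ffunE mulrDl.
Qed.

Fact grpalg_mulDr : right_distributive grpalg_mul +%R.
Proof.
move=> f g h; apply/ffunP => x; rewrite !ffunE -big_split /=.
by apply: eq_bigr => y _; rewrite ffunE mulrDr.
Qed.

Fact grpalg_oner_neq0 : grpalg_delta 1%g != 0.
Proof.
by apply/eqP => /ffunP/(_ 1%g)/eqP; rewrite !ffunE eqxx oner_eq0.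
Qed.

HB.instance Definition _ := GRing.Zmodule_isNzRing.Build (grpalg R G)
  grpalg_mulA grpalg_mul1l grpalg_mul1r grpalg_mulDl grpalg_mulDr
  grpalg_oner_neq0.

Fact grpalg_scaleAl (a : R) f g : a *: (f * g) = (a *: f) * g.
Proof.
apply/ffunP => x; rewrite !ffunE [LHS]mulr_sumr.
by apply: eq_bigr => y _; rewrite ffunE [RHS]mulrAC mulrA mulrAC.
Qed.

HB.instance Definition _ := GRing.Lmodule_isLalgebra.Build R (grpalg R G)
  grpalg_scaleAl.

Fact grpalg_scaleAr (a : R) f g : a *: (f * g) = f * (a *: g).
Proof.
apply/ffunP => x; rewrite !ffunE [LHS]mulr_sumr.
by apply: eq_bigr => y _; rewrite ffunE [LHS]mulrCA.
Qed.

HB.instance Definition _ := GRing.Lalgebra_isAlgebra.Build R (grpalg R G)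
  grpalg_scaleAr.

Definition class_function f : Prop := forall x y : G, f (x ^ y)%g = f x.

End GroupAlgebra.


Record wreath (gT : finGroupType) (n : nat) := Wreath {
  wbase : {ffun 'I_n -> gT};
  wperm : {perm 'I_n}
}.

Section WreathProduct.
Variables (gT : finGroupType) (n : nat).
Implicit Types x y z : wreath gT n.

Definition wreath_pair x := (wbase x, wperm x).
Definition pair_wreath (p : {ffun 'I_n -> gT} * {perm 'I_n}) : wreath gT n :=
  Wreath p.1 p.2.
Fact wreath_pairK : cancel wreath_pair pair_wreath. Proof. by case. Qed.

HB.instance Definition _ := Finite.copy (wreath gT n) (can_type wreath_pairK).

(** (g, s)(h, t) = (g s(h), s t) with s(h)_i = h_(s^-1 i). The product s t
    composes permutations as functions, t first; this is (t * s)%g here, since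
    [perm] composes from left to right. *)
Definition wreath_mul x y : wreath gT n :=
  Wreath [ffun i => wbase x i * wbase y ((wperm x)^-1 i)]%g
         (wperm y * wperm x)%g.

Definition wreath_one : wreath gT n := Wreath [ffun=> 1%g] 1%g.

Definition wreath_inv x : wreath gT n :=
  Wreath [ffun i => (wbase x (wperm x i))^-1]%g (wperm x)^-1%g.

Fact wreath_mulA : associative wreath_mul.
Proof.
move=> x y z; rewrite /wreath_mul /=; congr Wreath; last by rewrite mulgA.
by apply/ffunP => i; rewrite !ffunE invMg permM mulgA.
Qed.

Fact wreath_mul1 : left_id wreath_one wreath_mul.
Proof.
case=> g s; rewrite /wreath_mul /=; congr Wreath; last by rewrite mulg1.
by apply/ffunP => i; rewrite !ffunE invg1 perm1 mul1g.
Qed.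

Fact wreath_mulV : left_inverse wreath_one wreath_inv wreath_mul.
Proof.
case=> g s; rewrite /wreath_mul /=; congr Wreath; last by rewrite mulgV.
by apply/ffunP => i; rewrite !ffunE invgK mulVg.
Qed.

HB.instance Definition _ := Finite_isGroup.Build (wreath gT n)
  wreath_mulA wreath_mul1 wreath_mulV.

(** For i in the cycle (i = i_1 i_2 ... i_k) of s = wperm x, where
    i_(m+1) = s i_m, this is the conjugacy class of g_(i_k) ... g_(i_1). *)
Definition cycle_product x (i : 'I_n) : {set gT} :=
  ((\prod_(j <- rev (traject (wperm x) i #|porbit (wperm x) i|)) wbase x j)
     ^: [set: gT])%g.

Lemma cycle_product_perm x i :
  cycle_product x (wperm x i) = cycle_product x i.
Proof.
rewrite /cycle_product.
have -> : porbit (wperm x) (wperm x i) = porbit (wperm x) i.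
  by have := porbit_perm (wperm x) 1 i; rewrite expg1.
have := iter_porbit (wperm x) i; case: #|_| => [|m] => [_|Em].
  by rewrite !big_nil.
rewrite [traject _ (_ i) _]trajectSr -iterSr Em trajectS rev_rcons rev_cons.
rewrite big_cons -cats1 big_cat big_seq1.
by rewrite -[in RHS](classGidl _ (in_setT (wbase x i)^-1)%g) conjgE invgK mulgK.
Qed.

(** The partition rho(c), listed in decreasing order. By the previous lemma all
    the points of a cycle have the same cycle product. *)
Definition wreath_type x (c : {set gT}) : seq nat :=
  sort geq [seq #|C| | C : {set 'I_n} <- enum
    [set C in porbits (wperm x) | [exists i in C, cycle_product x i == c]]].

Definition factor_embedding (i : 'I_n) (g : gT) : wreath gT n :=
  Wreath [ffun k => if k == i then g else 1%g] 1%g.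

Definition JM_set (i j : 'I_n) : {set wreath gT n} :=
  [set x | [&& wperm x == tperm i j,
               [forall k, (k != i) && (k != j) ==> (wbase x k == 1%g)] &
               wbase x j == (wbase x i)^-1%g]].

End WreathProduct.

Section WreathAlgebra.
Variables (R : comNzRingType) (gT : finGroupType) (n : nat).
Implicit Types gamma : grpalg R gT.

Definition factor_elt gamma (i : 'I_n) : grpalg R (wreath gT n) :=
  \sum_(g : gT) gamma g *: grpalg_delta R (factor_embedding i g).

Definition jucys_murphy (j : 'I_n) : grpalg R (wreath gT n) :=
  \sum_(i < n | (i < j)%N) \sum_(a in JM_set gT i j) grpalg_delta R a.

(** gamma (repr c) is the value of the class function gamma on c. *)
Definition eta gamma : grpalg R (wreath gT n) :=
  [ffun x => \prod_(c in classes [set: gT])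
     gamma (repr c) ^+ size (wreath_type x c)].

Definition epsilon gamma : grpalg R (wreath gT n) :=
  [ffun x => (-1) ^+ wperm x * eta gamma x].

End WreathAlgebra.

Arguments jucys_murphy R gT {n} j.
Arguments eta {R gT} n gamma.
Arguments epsilon {R gT} n gamma.

(* Main.v *)
Require Import Defs.
From mathcomp Require Import all_boot all_order all_algebra all_fingroup.
From mathcomp Require Import complex.
From mathcomp Require Import reals.

(** Write K(i,j) also for the sum of its elements. Conjugation by x = (g, s)
    maps K(i,j) to K(s i, s j), whatever g is. Hence xi_j commutes with every x
    whose permutation fixes all the points i >= j, and all the commutation
    relations follow. For the product formulas, every element x of Gamma_(k+1)
    is in a unique way a product y z with y in Gamma_k and z either in the
    factor Gamma^(k+1) or in some K(i,k+1). Multiplying by z^-1 removes the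
    point k+1 from its cycle in x: it splits off the factor gamma(g) when k+1 is
    fixed, and otherwise it leaves the cycle products unchanged and flips the
    sign of the permutation. *)

Set Implicit Arguments.
Unset Strict Implicit.
Unset Printing Implicit Defensive.

Import GRing.Theory.

Local Open Scope ring_scope.

(** * Commutation relations in the group algebra of the wreath product *)

Section Commutation.
Variables (R : comNzRingType) (gT : finGroupType) (n : nat).
Implicit Types (x y : wreath gT n) (i j k : 'I_n) (g h : gT).
Local Notation W := (wreath gT n).
Local Notation delta := (@grpalg_delta R W).

Lemma wbaseM x y i :
  wbase (x * y)%g i = (wbase x i * wbase y ((wperm x)^-1 i))%g.
Proof. by rewrite ffunE. Qed.

Lemma wpermM x y : wperm (x * y)%g = (wperm y * wperm x)%g.
Proof. by []. Qed.

Lemma wreath_eqP x y :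
  wbase x =1 wbase y -> wperm x =1 wperm y -> x = y.
Proof.
by case: x y => b s [c t] /= /ffunP-> /permP->.
Qed.

Lemma mul_delta x y : delta x * delta y = delta (x * y)%g.
Proof.
apply/ffunP => z; rewrite !ffunE (bigD1 x) //= !ffunE eqxx mul1r.
rewrite big1 ?addr0 => [|w /negPf nw]; last by rewrite ffunE nw mul0r.
by rewrite -(inj_eq (mulgI x)) mulKVg.
Qed.

Lemma mulr_delta (f : grpalg R W) y x : (f * delta y) x = f (x * y^-1)%g.
Proof.
rewrite ffunE (bigD1 (x * y^-1)%g) //= ffunE invMg invgK mulgKV eqxx mulr1.
rewrite big1 ?addr0 // => w nw; rewrite ffunE.
case: eqP => [e|]; last by rewrite mulr0.
by case/eqP: nw; rewrite -e invMg invgK mulKVg.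
Qed.

(** Parametrizes K(i,j) by the entry at [i], so that sums over K(i,j) become sums over the group.
    This requires [i != j]: otherwise the first test hides the second. *)
Definition JM_elt i j g : W :=
  Wreath [ffun k => if k == i then g else if k == j then g^-1%g else 1%g]
         (tperm i j).

Definition JM_sum i j : grpalg R W := \sum_g delta (JM_elt i j g).

Lemma JM_setE i j : i != j -> JM_set gT i j = [set JM_elt i j g | g : gT].
Proof.
move=> nij; apply/setP => x; rewrite inE; apply/and3P/imsetP.
  case=> /eqP sx /forallP x1 /eqP xj; exists (wbase x i) => //.
  apply: wreath_eqP => k; last by rewrite sx.
  rewrite ffunE; case: eqP => [->//|/eqP ni]; case: eqP => [->//|/eqP nj].
  by have := x1 k; rewrite ni nj => /eqP.
case=> g _ ->; split=> //=; last first.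
  by rewrite !ffunE !eqxx [j == i]eq_sym (negPf nij).
by apply/forallP => k; rewrite ffunE; case: eqP; case: eqP => //=.
Qed.

Lemma jucys_murphyE j :
  jucys_murphy R gT j = \sum_(i < n | (i < j)%N) JM_sum i j.
Proof.
apply: eq_bigr => i lij; have nij : i != j by rewrite neq_ltn lij.
rewrite JM_setE // big_imset //= => g h _ _ /(congr1 (fun x => wbase x i)).
by rewrite !ffunE eqxx.
Qed.

(** Conjugation turns the entries [g] and [g^-1] into [a g b^-1] and [b g^-1 a^-1], with [a] and [b]
    the entries of [x] at the images of [i] and [j]; these are again mutually inverse. At all other
    points the entries of [x] cancel. *)
Lemma JM_eltJ x i j g : i != j ->
  (x * JM_elt i j g = JM_elt (wperm x i) (wperm x j)
     (wbase x (wperm x i) * g * (wbase x (wperm x j))^-1) * x)%g.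
Proof.
move=> nij; have s_inj := @perm_inj _ (wperm x).
apply: wreath_eqP => k.
  rewrite !wbaseM !ffunE /= tpermV.
  have sE l : ((wperm x)^-1%g k == l) = (k == wperm x l).
    by rewrite -(inj_eq s_inj) permKV.
  rewrite !sE; case: tpermP => [->|->|/eqP/negPf-> /eqP/negPf->].
  - by rewrite eqxx mulgKV.
  - by rewrite eqxx (inj_eq s_inj) eq_sym (negPf nij) !invMg invgK mulgA mulgKV.
  - by rewrite mul1g mulg1.
by rewrite !wpermM !permM inj_tperm.
Qed.

(** As [g] runs over the group, so does [a g b^-1]; hence the base part of [x] disappears on
    summing. *)
Lemma JM_sumJ x i j : i != j ->
  delta x * JM_sum i j = JM_sum (wperm x i) (wperm x j) * delta x.
Proof.
move=> nij; rewrite mulr_sumr mulr_suml.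
pose a := wbase x (wperm x i); pose b := wbase x (wperm x j).
have h_inj : injective (fun g => a * g * b^-1)%g.
  by move=> g h /mulIg/mulgI.
rewrite [RHS](reindex_inj h_inj) /=.
by apply: eq_bigr => g _; rewrite !mul_delta JM_eltJ.
Qed.

(** The permutation of [x] fixes [j] and permutes the points below [j], so conjugation by [x]
    permutes the sets K(i,j) with [i < j]. *)
Lemma jucys_murphy_comm x j :
    (forall i, (j <= i)%N -> wperm x i = i) ->
  GRing.comm (jucys_murphy R gT j) (delta x).
Proof.
move=> xj; rewrite /GRing.comm jucys_murphyE mulr_suml mulr_sumr.
rewrite (reindex_inj (@perm_inj _ (wperm x))) /=.
apply: eq_big => i; last first.
  move=> lij; have nij : i != j.
    by apply: contraTneq lij => ->; rewrite xj ?ltnn.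
  by rewrite (JM_sumJ _ nij) [wperm x j]xj.
apply/idP/idP => lij; rewrite ltnNge.
  by apply: contraTN lij => lji; rewrite xj -?leqNgt.
(* If the image of [i] is at least [j], it is a fixed point, and injectivity makes it equal to
   [i]. *)
apply: contraTN lij => lji; rewrite -leqNgt.
by have /perm_inj <- := xj _ lji.
Qed.

Lemma factor_embeddingM i j g h : i != j ->
  (factor_embedding i g * factor_embedding j h =
   factor_embedding j h * factor_embedding i g)%g.
Proof.
move=> nij; apply: wreath_eqP => // k.
rewrite !wbaseM !ffunE /= invg1 perm1; case: eqP => [->|_].
  by rewrite (negPf nij) mul1g mulg1.
by rewrite mul1g mulg1.
Qed.

Lemma factor_elt_comm gamma i j :
  GRing.comm (factor_elt (n := n) (gamma : grpalg R gT) i) (factor_elt gamma j).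
Proof.
have [->|nij] := eqVneq i j; first exact: commr_refl.
apply: commr_sum => h _; apply/commr_sym/commr_sum => g _.
rewrite /GRing.comm -!scalerAl -!scalerAr !mul_delta scalerA mulrC -scalerA.
by rewrite factor_embeddingM // eq_sym.
Qed.

Lemma jucys_murphy_factor_comm gamma i j :
  GRing.comm (jucys_murphy R gT i) (factor_elt (gamma : grpalg R gT) j).
Proof.
apply: commr_sum => g _; rewrite /GRing.comm -scalerAl -scalerAr.
by rewrite jucys_murphy_comm // => k _; rewrite perm1.
Qed.

(** For [i < j], the transpositions in the terms of the [i]-th element move only points below [j],
    so each term satisfies the criterion of [jucys_murphy_comm]. *)
Lemma jucys_murphy_commute i j :
  GRing.comm (jucys_murphy R gT i) (@jucys_murphy R gT n j).
Proof.
wlog lij : i j / (i < j)%N => [th|].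
  have [/th//|/th/commr_sym//|/val_inj->] := ltngtP i j; exact: commr_refl.
rewrite [X in GRing.comm X _]jucys_murphyE; apply/commr_sym/commr_sum => l lli.
apply: commr_sum => g _; apply: jucys_murphy_comm => k ljk /=.
rewrite tpermD // neq_ltn; first by rewrite (ltn_trans lli (leq_trans lij ljk)).
by rewrite (leq_trans lij ljk).
Qed.
End Commutation.

(** * Orbits of a permutation listed as cyclic sequences *)

Section PermCycles.
Variable (T : finType).
Implicit Types (s t : {perm T}) (p : seq T).

Lemma porbit_fcycle s p (i : T) :
  fcycle s p -> uniq p -> i \in p -> porbit s i =i p.
Proof.
move=> cp up ip j; rewrite -(fconnect_cycle cp ip); apply/porbitP/idP.
  by case=> m ->; rewrite permX fconnect_iter.
by move/iter_findex => <-; exists (findex s i j); rewrite permX.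
Qed.

Lemma fcycle_traject_porbit s i : fcycle s (traject s i #|porbit s i|).
Proof.
have := iter_porbit s i; have := card_porbit_neq0 s i.
case: #|_| => // m _ si /=; rewrite rcons_path fpath_traject /=.
by rewrite last_traject -iterS si.
Qed.
End PermCycles.

(** * Cycle products, and the removal of a point from its cycle *)

Section CycleProducts.
Variables (gT : finGroupType) (n : nat).
Implicit Types (x y : wreath gT n) (i j k : 'I_n) (g h : gT).

Lemma class_mulC g h : ((g * h)^: [set: gT] = (h * g)^: [set: gT])%g.
Proof. by rewrite -(classGidl (g * h) (in_setT g)) conjgE mulgA mulKg. Qed.

(** Allows a cycle product to be computed from an explicit listing, as when a cycle is obtained by
    editing another one. *)
Lemma cycle_product_fcycle x i p :
    fcycle (wperm x) (i :: p) -> uniq (i :: p) ->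
  cycle_product x i = ((\prod_(j <- rev (i :: p)) wbase x j) ^: [set: gT])%g.
Proof.
move=> cp up; rewrite /cycle_product.
rewrite (eq_card (porbit_fcycle cp up (mem_head _ _))) (card_uniqP up).
by move: cp; rewrite /= rcons_path => /andP[/fpathE <- _].
Qed.

Lemma cycle_product_porbit x i j :
  j \in porbit (wperm x) i -> cycle_product x j = cycle_product x i.
Proof.
case/porbitP => m ->; elim: m => [|m IH]; first by rewrite perm1.
by rewrite expgSr permM cycle_product_perm.
Qed.

(** A listing of the cycle of [j] under [x] is also one under [y]. This handles the cycles that a
    multiplication leaves untouched. *)
Lemma eq_cycle_product x y j :
    {in porbit (wperm x) j, wperm y =1 wperm x} ->
    {in porbit (wperm x) j, wbase y =1 wbase x} ->
  porbit (wperm y) j = porbit (wperm x) j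
  /\ cycle_product y j = cycle_product x j.
Proof.
move=> eqs eqb; have := fcycle_traject_porbit (wperm x) j.
have := uniq_traject_porbit (wperm x) j; have := porbit_traject (wperm x) j.
have := card_porbit_neq0 (wperm x) j; case: #|_| => // m _ /=.
set q := traject _ _ _ => qE uq cq.
have cyq : fcycle (wperm y) (j :: q).
  rewrite (eq_in_cycle (P := mem (j :: q)) (e' := frel (wperm x))) //.
    by move=> a b aq bq /=; rewrite eqs // qE.
  by apply/allP.
split.
  by apply/setP => a; rewrite qE (porbit_fcycle cyq uq) ?mem_head.
rewrite (cycle_product_fcycle cyq) // (cycle_product_fcycle cq) //.
congr (_ ^: _)%g; apply: eq_big_seq => a; rewrite mem_rev => aq.
by rewrite eqb // qE.
Qed.

Lemma JM_eltV i j g : i != j -> ((JM_elt i j g)^-1 = JM_elt i j g)%g.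
Proof.
move=> nij; apply: (mulgI (JM_elt i j g)); rewrite mulgV; apply/esym.
apply: wreath_eqP => k; last by rewrite wpermM tperm2.
rewrite wbaseM !ffunE /= tpermV.
case: tpermP => [->|->|/eqP/negPf-> /eqP/negPf->].
- by rewrite eqxx [j == i]eq_sym (negPf nij) eqxx mulgV.
- by rewrite eqxx [j == i]eq_sym (negPf nij) eqxx mulVg.
- by rewrite mulg1.
Qed.

Lemma wbase_mul_JM x i j g k : i != j ->
  wbase (x * JM_elt i j g)%g k =
    if k == wperm x i then (wbase x k * g)%g
    else if k == wperm x j then (wbase x k * g^-1)%g else wbase x k.
Proof.
move=> nij; rewrite wbaseM ffunE.
have sE l : ((wperm x)^-1%g k == l) = (k == wperm x l).
  by rewrite -(inj_eq (@perm_inj _ (wperm x))) permKV.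
by rewrite !sE; case: eqP => // _; case: eqP => // _; rewrite mulg1.
Qed.

Lemma wbase_mul_factorV x i g k :
  wbase (x * (factor_embedding i g)^-1)%g k =
    if k == wperm x i then (wbase x k * g^-1)%g else wbase x k.
Proof.
rewrite wbaseM !ffunE perm1.
rewrite -(inj_eq (@perm_inj _ (wperm x))) permKV.
by case: eqP; rewrite // invg1 mulg1.
Qed.

Lemma wperm_mul_factorV x i g :
  wperm (x * (factor_embedding i g)^-1)%g = wperm x.
Proof. by rewrite wpermM /= invg1 mul1g. Qed.

(** Write [s] for the permutation of [x]. Then [y] fixes [k] with entry 1, sends [i] directly to
    [s k], and its entry at [s k] absorbs that of [k] as a right factor; elsewhere it agrees with
    [x]. *)
Lemma remove_point x i k j :
    wperm x i = k -> i != k -> j != k ->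
    let y := (x * JM_elt i k (wbase x k)^-1)%g in
  porbit (wperm y) j = porbit (wperm x) j :\ k
  /\ cycle_product y j = cycle_product x j.
Proof.
move=> sik nik njk y; set s := wperm x.
have s_inj : injective s := @perm_inj _ s.
have nskk : s k != k by rewrite -{2}sik (inj_eq s_inj) eq_sym.
have yE l : l != k -> s l != k -> wperm y l = s l.
  move=> nlk; rewrite -{1}sik (inj_eq s_inj) => nli.
  by rewrite wpermM permM tpermD // eq_sym.
have yi : wperm y i = s k by rewrite wpermM permM tpermL.
have by1 l : l != k -> l != s k -> wbase y l = wbase x l.
  by move=> nlk nls; rewrite wbase_mul_JM // sik (negPf nlk) (negPf nls).
have by2 : wbase y (s k) = (wbase x (s k) * wbase x k)%g.
  by rewrite wbase_mul_JM // sik (negPf nskk) eqxx invgK.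
(* A cycle that avoids [k] also avoids [i] and [s k], the other points where [y] and [x] may
   differ. *)
have [kj|nkj] := boolP (k \in porbit s j); last first.
  have nl l : l \in porbit s j -> [/\ l != k, s l != k & l != s k].
    move=> lj; split; first by apply: contraNneq nkj => <-.
      apply: contraNneq nkj => <-; move/porbitP: lj => [m ->].
      by rewrite -permM -expgSr mem_porbit.
    apply: contraNneq nkj => /(congr1 (fun z => z \in porbit s j)); rewrite lj.
    have := porbit_perm s 1 k; rewrite expg1 => E.
    by rewrite porbit_sym -eq_porbit_mem E eq_porbit_mem porbit_sym.
  have [-> ->] : porbit (wperm y) j = porbit s j
                 /\ cycle_product y j = cycle_product x j.
    by apply: eq_cycle_product => l /nl[? ? ?]; [exact: yE | exact: by1].
  split=> //; apply/setP => l; rewrite !inE.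
  by case: eqP => // ->; rewrite (negPf nkj).
have skE : porbit s (s k) = porbit s k.
  by have := porbit_perm s 1 k; rewrite expg1.
have jk : j \in porbit s (s k) by rewrite skE porbit_sym.
(* Listing the cycle of k from s k puts k last. Removing k then moves its factor
   from one end of the product to the other, which is a conjugation. *)
have [q [cq uq]] : exists q,
    fcycle s (rcons (s k :: q) k) /\ uniq (rcons (s k :: q) k).
  have := fcycle_traject_porbit s (s k); have := uniq_traject_porbit s (s k).
  have := card_porbit_neq0 s k; have := iter_porbit s (s k).
  rewrite skE -iterSr; case: #|_| => [|[|m]] /perm_inj // => [/eqP|e _].
    by rewrite (negPf nskk).
  have {}e : iter m.+2 s k = k := e.
  by rewrite trajectSr -iterSr e trajectS; exists (traject s (s (s k)) m).
have porE l := porbit_fcycle cq uq (i := l).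
move: (uq); rewrite rcons_uniq => /andP[nkq uq'].
(* Without its last entry [k], the list ends in [i], which [y] sends back to the head [s k]. *)
have cyq : fcycle (wperm y) (s k :: q).
  move: cq; rewrite /= !rcons_path /= last_rcons => /andP[/andP[pq /eqP lq] _].
  have -> : last (s k) q = i by apply: s_inj; rewrite lq.
  rewrite yi eqxx andbT.
  have qk : all (predC1 k) (s k :: q).
    by apply/allP => l lq' /=; apply: contraNneq nkq => lk; rewrite -{1}lk.
  apply: (sub_in_path _ qk pq) => a b; rewrite !inE /= => nak nbk /eqP sab.
  by rewrite yE ?sab.
have jq : j \in s k :: q.
  by move: jk; rewrite porE ?mem_rcons ?inE ?eqxx ?orbT // (negPf njk).
split.
  apply/setP => l; rewrite (porbit_fcycle cyq uq' jq) in_setD1.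
  rewrite porE ?mem_rcons ?(in_cons k _ j) ?jq ?orbT // (in_cons k _ l).
  by case: (eqVneq l k) => [->|_] //=; apply: negPf.
have -> : cycle_product x j = cycle_product x (s k).
  exact: cycle_product_porbit.
have -> : cycle_product y j = cycle_product y (s k).
  by apply: cycle_product_porbit; rewrite (porbit_fcycle cyq uq') ?mem_head.
rewrite (cycle_product_fcycle cyq uq') (cycle_product_fcycle cq uq).
rewrite -[_ :: rcons _ _]rcons_cons rev_rcons rev_cons big_cons.
rewrite -!cats1 !big_cat !big_seq1.
(* After rotation only the factors along [q] remain to be compared; [q] avoids [k] and [s k], so [x]
   and [y] have the same entries there. *)
rewrite by2 mulgA class_mulC [RHS]class_mulC -!mulgA.
congr ((_ * (_ * _)) ^: _)%g.
apply: eq_big_seq => l; rewrite mem_rev => lq; apply: by1.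
  by apply: contraNneq nkq => lk; rewrite -{1}lk inE lq orbT.
by apply: contraTneq lq => ->; case/andP: uq'.
Qed.
End CycleProducts.

(** * The product formulas, by induction on the number of factors *)

Section ProductFormula.
Variables (R : comNzRingType) (gT : finGroupType) (n : nat).
Variable gamma : grpalg R gT.
Hypothesis gamma_cf : class_function gamma.
Implicit Types (x y : wreath gT n) (s : {perm 'I_n}) (i j k : 'I_n) (g h : gT).
Local Notation W := (wreath gT n).

(** The least element of a cycle represents it, so that products over the cycles
    become products over points, and removing the largest point changes no
    representative. *)
Definition cycle_min s j := [forall i in porbit s j, (j <= i)%N].

Definition cycle_weight x j := gamma (repr (cycle_product x j)).

Lemma repr_class_function g : gamma (repr (g ^: [set: gT])%g) = gamma g.
Proof. by have /imsetP[h _ ->] := mem_repr _ (class_refl [set: gT] g). Qed.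

(** Sending a point to its orbit is a bijection from the cycle minima to the cycles: two minima of
    one cycle bound each other, and each cycle has a least point. *)
Lemma card_cycle_min x c :
  #|[pred j | cycle_min (wperm x) j & cycle_product x j == c]|
    = size (wreath_type x c).
Proof.
rewrite size_sort size_map -cardE; set s := wperm x.
rewrite -(card_in_imset (f := porbit s)) => [|i j].
  apply: eq_card => C; rewrite inE; apply/imsetP/andP.
    case=> j /andP[_ cj] ->; rewrite imset_f //; split=> //.
    by apply/exists_inP; exists j => //; exact: porbit_id.
  case=> /imsetP[i _ ->] /exists_inP[l li /eqP cl].
  case: (arg_minnP (fun j : 'I_n => j : nat) (porbit_id s i)) => j ji jmin.
  have ij : porbit s i = porbit s j by apply/eqP; rewrite eq_sym eq_porbit_mem.
  exists j => //; apply/andP; split; first by apply/forall_inP; rewrite -ij.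
  by rewrite -cl (cycle_product_porbit ji) (cycle_product_porbit li).
move=> /andP[/forall_inP imin _] /andP[/forall_inP jmin _] ij.
apply/val_inj/eqP; rewrite eqn_leq imin ?jmin // ?ij ?porbit_id //.
by rewrite -ij porbit_id.
Qed.

Lemma etaE x :
  eta n gamma x = \prod_(j | cycle_min (wperm x) j) cycle_weight x j.
Proof.
rewrite ffunE (partition_big (cycle_product x) (mem (classes [set: gT]))) /=.
  apply: eq_bigr => c _; rewrite -card_cycle_min -prodr_const.
  by apply: eq_bigr => j /andP[_ /eqP]; rewrite /cycle_weight => ->.
by move=> j _; apply: mem_classes; rewrite inE.
Qed.

(** The subgroup Gamma_m inside Gamma_n. Points are numbered from 0, so [k] is the last point on
    which Gamma_(k+1) can act. *)
Definition wreath_supp m x :=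
  [forall j : 'I_n, (m <= j)%N ==> (wperm x j == j) && (wbase x j == 1%g)].

Lemma wreath_suppP m x :
  reflect (forall j, (m <= j)%N -> wperm x j = j /\ wbase x j = 1%g)
          (wreath_supp m x).
Proof.
apply: (iffP forall_inP) => H j mj; first by have /andP[/eqP ? /eqP] := H j mj.
by have [-> ->] := H j mj; rewrite !eqxx.
Qed.

(** For e = 1 and e = -1, the functions eta_m and epsilon_m on Gamma_m, extended
    by zero to Gamma_n. *)
Definition eta_trunc (e : R) m : grpalg R W :=
  [ffun x => if wreath_supp m x then
     e ^+ wperm x * \prod_(j < n | (j < m)%N && cycle_min (wperm x) j)
       cycle_weight x j else 0].

Lemma eta_trunc0 e : eta_trunc e 0 = 1.
Proof.
apply/ffunP => x; rewrite !ffunE.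
have -> : wreath_supp 0 x = (x == 1%g).
  apply/wreath_suppP/eqP => [H|-> j _]; last by rewrite /= ffunE perm1.
  by apply: wreath_eqP => j; rewrite ?ffunE ?perm1; have [] := H j isT.
by case: eqP => // ->; rewrite big_pred0 // odd_perm1 expr0 mulr1.
Qed.

Lemma eta_truncn e x :
  eta_trunc e n x = e ^+ wperm x * eta n gamma x.
Proof.
rewrite etaE ffunE; have -> : wreath_supp n x.
  by apply/wreath_suppP => j; rewrite leqNgt ltn_ord.
by congr (_ * _); apply: eq_bigl => j; rewrite ltn_ord.
Qed.

(** With [wreath_supp_JM], this gives the unique decomposition: [x] determines which kind of [z]
    applies, and then the parameters of [z]. *)
Lemma wreath_supp_factor x k g :
  wreath_supp k (x * (factor_embedding k g)^-1)%g
    = [&& wreath_supp k.+1 x, wperm x k == k & wbase x k == g].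
Proof.
apply/wreath_suppP/and3P => [H|[/wreath_suppP H /eqP sk /eqP xk] j kj].
  have [] := H k (leqnn k); rewrite wperm_mul_factorV wbase_mul_factorV => sk.
  rewrite sk eqxx => /eqP; rewrite -eq_mulgV1 => xk; split=> //.
  apply/wreath_suppP => j kj; have [] := H j (ltnW kj).
  rewrite wperm_mul_factorV wbase_mul_factorV sk.
  by case: eqP => // jk; rewrite jk ltnn in kj.
rewrite wperm_mul_factorV wbase_mul_factorV sk; move: kj; rewrite leq_eqVlt.
case/predU1P => [/val_inj <-|kj]; first by rewrite eqxx sk xk mulgV.
by have [-> ->] := H j kj; case: eqP => // jk; rewrite jk ltnn in kj.
Qed.

Lemma wreath_supp_JM x i k g : (i < k)%N ->
  wreath_supp k (x * JM_elt i k g)%g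
    = [&& wreath_supp k.+1 x, wperm x i == k & wbase x k == g^-1%g].
Proof.
move=> ik; have nik : i != k by rewrite neq_ltn ik.
have yE j : wperm (x * JM_elt i k g)%g j = wperm x (tperm i k j).
  by rewrite wpermM permM.
have s_inj : injective (wperm x) := @perm_inj _ _.
apply/wreath_suppP/and3P => [H|[/wreath_suppP H /eqP sk /eqP xk] j].
  have [] := H k (leqnn k); rewrite yE tpermR => si.
  rewrite wbase_mul_JM // si eqxx => /eqP; rewrite -eq_invg_mul => xk.
  split=> //; last by rewrite -(inj_eq invg_inj) invgK.
  apply/wreath_suppP => j kj; have [] := H j (ltnW kj).
  have nkj : k != j by rewrite neq_ltn kj.
  have nij : i != j by rewrite neq_ltn (ltn_trans ik kj).
  rewrite yE tpermD // => sj.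
  rewrite wbase_mul_JM // si [j == k]eq_sym (negPf nkj).
  suff /negPf-> : j != wperm x k by [].
  by rewrite -[X in X != _]sj (inj_eq s_inj) eq_sym.
rewrite leq_eqVlt => /predU1P[/val_inj <-|kj].
  by rewrite yE tpermR wbase_mul_JM // sk eqxx xk mulVg.
have [sj xj] := H j kj.
have nkj : k != j by rewrite neq_ltn kj.
have nij : i != j by rewrite neq_ltn (ltn_trans ik kj).
rewrite yE tpermD // wbase_mul_JM // sk [j == k]eq_sym (negPf nkj).
suff /negPf-> : j != wperm x k by [].
by rewrite -[X in X != _]sj (inj_eq s_inj) eq_sym.
Qed.

Lemma mul_factor_elt (f : grpalg R W) k x :
  (f * factor_elt gamma k) x
    = \sum_g gamma g * f (x * (factor_embedding k g)^-1)%g.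
Proof.
rewrite mulr_sumr sum_ffunE; apply: eq_bigr => g _.
by rewrite -scalerAr ffunE -mulr_delta.
Qed.

Lemma mul_jucys_murphy (f : grpalg R W) k x :
  (f * jucys_murphy R gT k) x
    = \sum_(i < n | (i < k)%N) \sum_g f (x * JM_elt i k g)%g.
Proof.
rewrite jucys_murphyE mulr_sumr sum_ffunE; apply: eq_bigr => i ik.
rewrite mulr_sumr sum_ffunE; apply: eq_bigr => g _.
by rewrite mulr_delta JM_eltV // neq_ltn ik.
Qed.

(** The cycle formed by [k] alone contributes [gamma (wbase x k)]. The division changes only the
    entry at [k], so the other cycles keep their weights. *)
Lemma eta_trunc_fixed e x k : wreath_supp k.+1 x -> wperm x k = k ->
  eta_trunc e k.+1 x =
    gamma (wbase x k)
      * eta_trunc e k (x * (factor_embedding k (wbase x k))^-1)%g.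
Proof.
move=> Sx sk; set y := (x * _)%g; have sy : wperm y = wperm x.
  exact: wperm_mul_factorV.
rewrite !ffunE Sx wreath_supp_factor Sx sk !eqxx sy [RHS]mulrCA; congr (_ * _).
have ck : fcycle (wperm x) [:: k] by rewrite /= sk eqxx.
have ok := porbit_fcycle ck isT (mem_head k [::]).
rewrite (bigD1 k) /=; last first.
  by rewrite leqnn; apply/forall_inP => j; rewrite ok inE => /eqP->.
congr (_ * _).
  rewrite /cycle_weight (cycle_product_fcycle ck) // big_seq1.
  exact: repr_class_function.
apply: eq_big => [j|j /andP[/andP[_ _] njk]].
  rewrite ltnS leq_eqVlt -val_eqE.
  by case: ltngtP => //=; rewrite ?andbF ?andbT.
rewrite /cycle_weight; have [||_ ->//] := @eq_cycle_product _ _ x y j.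
  by move=> l lj; rewrite sy.
move=> l lj; rewrite wbase_mul_factorV sk; case: eqP => // lk.
by move: lj; rewrite lk porbit_sym ok inE (negPf njk).
Qed.

Lemma eta_trunc_remove e x i k : e * e = 1 ->
    wreath_supp k.+1 x -> wperm x i = k -> (i < k)%N ->
  eta_trunc e k.+1 x = e * eta_trunc e k (x * JM_elt i k (wbase x k)^-1)%g.
Proof.
move=> ee Sx si ik; have nik : i != k by rewrite neq_ltn ik.
have /= := fun j => @remove_point _ _ x i k j si nik.
set y := (x * _)%g => rem.
rewrite !ffunE Sx wreath_supp_JM // Sx si invgK !eqxx /= mulrA; congr (_ * _).
  (* The transposition flips the parity, which costs one factor [e] because [e * e = 1]. *)
  rewrite [odd_perm (_ * _)]odd_mul_tperm nik /=.
  by case: odd_perm; rewrite /= ?mulr1 ?ee.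
have s_inj : injective (wperm x) := @perm_inj _ _.
(* Points above [k] are fixed and [k] is not, so its image lies below it. Hence [k] is not the least
   point of its cycle, and removing it changes no minimum. *)
have sk : (wperm x k < k)%N.
  case: ltngtP => // [|/val_inj] ksk; last first.
    by case/eqP: nik; apply: s_inj; rewrite si ksk.
  have [/s_inj e1 _] := wreath_suppP _ _ Sx _ ksk.
  by rewrite e1 ltnn in ksk.
apply: eq_big => [j|j /andP[_ mj]].
  rewrite ltnS leq_eqVlt; have [/val_inj->|njk] := eqVneq (j : nat) k.
    rewrite ltnn; apply/negbTE/forall_inP => H.
    have := H (wperm x k); rewrite leqNgt sk => /(_ _)/notF; apply.
    by have := mem_porbit (wperm x) 1 k; rewrite expg1.
  rewrite /=; case: ltnP => //= jk.
  rewrite /cycle_min; have [-> _] := rem j njk.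
  apply/forall_inP/forall_inP => H l lj; first by apply: H; case/setD1P: lj.
  have [->|nlk] := eqVneq l k; first exact: ltnW.
  by apply: H; rewrite !inE nlk.
rewrite /cycle_weight; have [|_ ->//] := rem j.
apply: contraTneq mj => ->; apply/forall_inP => H.
have := H (wperm x k); rewrite leqNgt sk => /(_ _)/notF; apply.
by have := mem_porbit (wperm x) 1 k; rewrite expg1.
Qed.

(** By unique decomposition at most one term of the two sums survives at [x]; [eta_trunc_fixed] or
    [eta_trunc_remove] evaluates it. *)
Lemma eta_truncS e k x : e * e = 1 ->
  (eta_trunc e k * factor_elt gamma k) x
    + e * (eta_trunc e k * jucys_murphy R gT k) x
    = eta_trunc e k.+1 x.
Proof.
move=> ee; rewrite mul_factor_elt mul_jucys_murphy.
have s_inj : injective (wperm x) := @perm_inj _ _.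
have F0 g : ~~ [&& wreath_supp k.+1 x, wperm x k == k & wbase x k == g] ->
    eta_trunc e k (x * (factor_embedding k g)^-1)%g = 0.
  by rewrite -wreath_supp_factor => /negPf S; rewrite ffunE S.
have J0 i g : (i < k)%N ->
    ~~ [&& wreath_supp k.+1 x, wperm x i == k & wbase x k == g^-1%g] ->
    eta_trunc e k (x * JM_elt i k g)%g = 0.
  by move=> ik; rewrite -wreath_supp_JM // => /negPf S; rewrite ffunE S.
have [Sx|/negPf NSx] := boolP (wreath_supp k.+1 x); last first.
  rewrite big1 ?add0r => [|g _]; last by rewrite F0 ?mulr0 // NSx.
  rewrite big1 ?mulr0 => [|i ik]; first by rewrite ffunE NSx.
  by rewrite big1 // => g _; rewrite J0 // NSx.
have [sk|nsk] := eqVneq (wperm x k) k.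
  rewrite [X in e * X]big1 ?mulr0 ?addr0 => [|i ik]; last first.
    rewrite big1 // => g _; rewrite J0 // -{2}sk (inj_eq s_inj).
    by rewrite -val_eqE (ltn_eqF ik) andbF.
  rewrite (bigD1 (wbase x k)) //= big1 ?addr0 => [|g ng]; last first.
    by rewrite F0 ?mulr0 // [_ == g]eq_sym (negPf ng) !andbF.
  by rewrite -eta_trunc_fixed.
rewrite big1 ?add0r => [|g _]; last by rewrite F0 ?mulr0 // (negPf nsk) andbF.
(* When [k] is moved, only its preimage [i] contributes, with [g] the inverse of the entry at
   [k]. *)
pose i := (wperm x)^-1%g k; have si : wperm x i = k by rewrite permKV.
have ik : (i < k)%N.
  case: ltngtP => // [|/val_inj] ki; last by case/eqP: nsk; rewrite -{1}ki.
  have [si' _] := wreath_suppP _ _ Sx _ ki.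
  by rewrite -si si' ltnn in ki.
rewrite (bigD1 i) //= [X in _ + X]big1 ?addr0 => [|j /andP[jk nji]]; last first.
  rewrite big1 // => g _; rewrite J0 // -si (inj_eq s_inj) (negPf nji).
  by rewrite andbF.
rewrite (bigD1 (wbase x k)^-1%g) //= [X in _ + X]big1 ?addr0 => [|g ng].
  by rewrite (@eta_trunc_remove e x i k).
rewrite J0 // -(inj_eq invg_inj) invgK [_^-1%g == g]eq_sym.
by rewrite (negPf ng) !andbF.
Qed.

Lemma prod_jucys_murphy e : e * e = 1 ->
  \prod_(j < n) (factor_elt gamma j + e *: jucys_murphy R gT j)
    = eta_trunc e n.
Proof.
move=> ee.
suff H m (lemn : (m <= n)%N) :
    \prod_(j < m) (factor_elt gamma (widen_ord lemn j)
       + e *: jucys_murphy R gT (widen_ord lemn j)) = eta_trunc e m.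
  rewrite -(H n (leqnn n)); apply: eq_bigr => j _.
  by congr (factor_elt _ _ + e *: jucys_murphy _ _ _); apply: val_inj.
elim: m lemn => [|m IH] lemn; first by rewrite big_ord0 eta_trunc0.
(* The last index [m] is viewed as a point of ['I_n], to play the role of [k] in [eta_truncS]. *)
rewrite big_ord_recr /= -[eta_trunc e m.+1]/(eta_trunc e (Ordinal lemn).+1).
have -> : widen_ord lemn ord_max = Ordinal lemn by apply: val_inj.
under eq_bigr => j _.
  have -> : widen_ord lemn (widen_ord (leqnSn m) j) = widen_ord (ltnW lemn) j.
    by apply: val_inj.
  over.
rewrite IH; apply/ffunP => x.
rewrite -eta_truncS // mulrDr -scalerAr ffunE; congr (_ + _).
by rewrite ffunE.
Qed.
End ProductFormula.

Theorem theorem3p2 (R : realType) (gT : finGroupType) (n : nat)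
    (n_gt0 : (0 < n)%N) (gamma : grpalg R[i] gT)
    (gamma_cf : class_function gamma) :
  [/\ (forall i j : 'I_n,
         GRing.comm (jucys_murphy R[i] gT i) (jucys_murphy R[i] gT j)),
      (forall i j : 'I_n,
         GRing.comm (factor_elt gamma i) (factor_elt gamma j)),
      (forall i j : 'I_n,
         GRing.comm (jucys_murphy R[i] gT i) (factor_elt gamma j)),
      eta n gamma
        = \prod_(j < n) (factor_elt gamma j + jucys_murphy R[i] gT j)
    & epsilon n gamma
        = \prod_(j < n) (factor_elt gamma j - jucys_murphy R[i] gT j)].
Proof.
(* Both formulas at once: [e = 1] yields [eta] and [e = -1] yields [epsilon]. *)
have prodE e : e * e = 1 -> \prod_(j < n) (factor_elt gamma j
    + e *: jucys_murphy R[i] gT j) = [ffun x => e ^+ wperm x * eta n gamma x].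
  move=> ee; rewrite prod_jucys_murphy //.
  by apply/ffunP => x; rewrite eta_truncn [RHS]ffunE.
split=> [i j|i j|i j||].
- exact: jucys_murphy_commute.
- exact: factor_elt_comm.
- exact: jucys_murphy_factor_comm.
- under eq_bigr => j _ do rewrite -[jucys_murphy _ _ j]scale1r.
  rewrite prodE ?mulr1 //; apply/ffunP => x.
  by rewrite [RHS]ffunE expr1n mul1r.
- under eq_bigr => j _ do rewrite -scaleN1r.
  by rewrite prodE // mulrNN mulr1.
Qed.
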